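(* Let $\delta>0$ and $\alpha>0$. For any $\varepsilon>0$ and any integer $N\ge1$ there exist cost functions $c_1,\dots,c_N:\mathbb{R}\to\mathbb{R}$ such that (1) each $c_n$ is continuous, vanishes on $(-\infty,0]$, and is convex and strictly increasing on $[0,\infty)$; (2) the socially optimal on-site generation $y^*$ is non-zero, i.e. the social cost minimization problem has an optimal solution $(\mathbf{s}^*,y^* )$ with $y^*>0$; (3) $\frac{\partial^+c_n(0)}{\partial s_n}\ge\frac{\alpha}{2N}$ for all $n$; and such that the on-site generation $y^a$ at the price-anticipating market equilibrium satisfies $$y^a-y^*\ge\delta-\varepsilon.$$
   Context: There are $N$ tenants; $\delta$ is the total energy reduction target; $y$ is the amount of on-site generation, with unit cost $\alpha$. $\partial^+$ denotes right derivative. The social cost minimization problem is $$\min\ \alpha y+\sum_{i=1}^N c_i(s_i)\quad\text{s.t.}\quad y+\sum_{i=1}^N s_i=\delta,\ s_i\ge0,\ y\ge0.$$ Supply function: $S(b_n,p)=\delta-\frac{b_n}{p}$. Clearing price: $p(\mathbf{b},y)=\frac{\sum_n b_n}{(N-1)\delta+y}$ (conventions $0/0=0$, $x/0=+\infty$ for $x>0$). Price-anticipating payoff (obtained with $p=\sqrt{(\sum_m b_m)\alpha/(N\delta)}$): for $\sum_m b_m>0$, $$Q_n(b_n;\mathbf{b}_{-n})=\sqrt{\frac{(\sum_m b_m)\alpha\delta}{N}}-b_n-c_n\!\left(\delta-\frac{b_n}{\sqrt{\sum_m b_m}}\sqrt{\frac{N\delta}{\alpha}}\right).$$ A price-anticipating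 market equilibrium is a triple $(\mathbf{b},p,y)$ with $\mathbf{b}\ge0$ such that $Q_n(b_n;\mathbf{b}_{-n})\ge Q_n(\bar b_n;\mathbf{b}_{-n})$ for all $n$ and all $\bar b_n\ge0$ for which this is defined; $p=p(\mathbf{b},y)$; and $y\in\arg\min_{0\le y'\le\delta}(\delta-y')p(\mathbf{b},y')+\alpha y'$. *)

(* Defs.v *)
From HB Require Import structures.
From mathcomp Require Import all_boot all_order all_algebra.
From mathcomp Require Import all_classical all_reals all_analysis.

Set Implicit Arguments.
Unset Strict Implicit.
Unset Printing Implicit Defensive.

Import Order.TTheory GRing.Theory Num.Theory.
Import numFieldNormedType.Exports.
Local Open Scope classical_set_scope.
Local Open Scope ring_scope.

Definition cost_function (R : realType) (f : R -> R) : Prop :=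
  [/\ continuous f,
      (forall x, x <= 0 -> f x = 0),
      convex_function (`[0, +oo[%classic : set R) f &
      {in `[0, +oo[ &, {homo f : x y / x < y}}].

Definition has_right_derivative (R : realType) (f : R -> R) (x l : R) : Prop :=
  (f (x + h) - f x) / h @[h --> 0^'+] --> l.

Definition social_cost (R : realType) (N : nat) (alpha : R)
    (c : 'I_N -> R -> R) (s : 'I_N -> R) (y : R) : R :=
  alpha * y + \sum_(i < N) c i (s i).

Definition social_feasible (R : realType) (N : nat) (delta : R)
    (s : 'I_N -> R) (y : R) : Prop :=
  [/\ y + \sum_(i < N) s i = delta, (forall i, 0 <= s i) & 0 <= y].

Definition social_optimal (R : realType) (N : nat) (delta alpha : R)
    (c : 'I_N -> R -> R) (s : 'I_N -> R) (y : R) : Prop :=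
  social_feasible delta s y /\
  forall (s' : 'I_N -> R) (y' : R), social_feasible delta s' y' ->
    social_cost alpha c s y <= social_cost alpha c s' y'.

(* The division of [\bar R] satisfies 0 / 0 = 0 and x / 0 = +oo for x > 0.
   The denominator vanishes only for N = 1 and y = 0. *)
Definition clearing_price (R : realType) (N : nat) (delta : R)
    (b : 'I_N -> R) (y : R) : \bar R :=
  ((\sum_(n < N) b n)%:E / ((N%:R - 1) * delta + y)%:E)%E.

Definition operator_cost (R : realType) (N : nat) (delta alpha : R)
    (b : 'I_N -> R) (y : R) : \bar R :=
  ((delta - y)%:E * clearing_price delta b y + (alpha * y)%:E)%E.

(* Meaningful only when [0 < \sum_m b m]. *)
Definition payoff (R : realType) (N : nat) (delta alpha : R)
    (c : 'I_N -> R -> R) (n : 'I_N) (b : 'I_N -> R) : R :=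
  let B := \sum_(m < N) b m in
  Num.sqrt (B * alpha * delta / N%:R) - b n
  - c n (delta - b n / Num.sqrt B * Num.sqrt (N%:R * delta / alpha)).

(* Payoffs are compared only where they are defined: the equilibrium bids, and
   the bids after each deviation considered, have a positive sum. *)
Definition price_anticipating_equilibrium (R : realType) (N : nat)
    (delta alpha : R) (c : 'I_N -> R -> R)
    (b : 'I_N -> R) (p : \bar R) (y : R) : Prop :=
  [/\ (forall n, 0 <= b n) /\ 0 < \sum_(n < N) b n,
      (forall (n : 'I_N) (x : R), 0 <= x ->
         0 < \sum_(m < N) [eta b with n |-> x] m ->
         payoff delta alpha c n [eta b with n |-> x]
           <= payoff delta alpha c n b),
      p = clearing_price delta b y &
      0 <= y <= delta /\
      forall y' : R, 0 <= y' <= delta ->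
        (operator_cost delta alpha b y <= operator_cost delta alpha b y')%E].

(* Main.v *)
(* Take every tenant's cost linear with slope beta, slightly below alpha, up to
   a kink m slightly below delta / N, and of slope beta + alpha beyond it.
   Socially, internal supply up to the kink is cheaper than generation and
   supply beyond it is dearer, so y* = delta - N m is small but positive.

   In the market, let p be the price the payoffs ascribe to the bids, that is
   sum_n b_n = N delta p^2 / alpha.  A tenant whose bid is at most the average
   gains by raising it unless
     p >= p0 = alpha / (2N) + beta (1 - 1 / (2N)),
   and p0 tends to alpha as beta does.  The operator's cost is minimal at
   (N - 1) delta + y = N delta p / alpha (clipped to 0 <= y <= delta), so
   p >= p0 forces y to be close to delta.  The bids p0^2 delta / alpha of all
   tenants form an equilibrium. *)

Require Import Defs.
From HB Require Import structures.
From mathcomp Require Import all_boot all_order all_algebra.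
From mathcomp Require Import all_classical all_reals all_analysis.
From mathcomp Require Import ring lra.

Set Implicit Arguments.
Unset Strict Implicit.
Unset Printing Implicit Defensive.

Import Order.TTheory GRing.Theory Num.Theory.
Import numFieldNormedType.Exports.
Local Open Scope classical_set_scope.
Local Open Scope ring_scope.

(** * Piecewise linear tenant costs *)

Definition kink_cost (R : realType) (b g m s : R) : R :=
  b * Num.max 0 s + g * Num.max 0 (s - m).

Lemma kink_costE (R : realType) (b g m s : R) : 0 <= s <= m ->
  kink_cost b g m s = b * s.
Proof.
move=> /andP[s0 sm]; rewrite /kink_cost (max_r s0) max_l ?mulr0 ?addr0//.
by rewrite subr_le0.
Qed.

(** The sign of [s] is free because a large bid makes a tenant's supply [delta - x / p] negative. *)
Lemma kink_cost_ge_linear (R : realType) (b g m s : R) : 0 <= b -> 0 <= g ->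
  b * s <= kink_cost b g m s.
Proof.
move=> b0 g0; rewrite -[leLHS]addr0 lerD// ?ler_wpM2l ?mulr_ge0//;
by rewrite le_max lexx ?orbT.
Qed.

Lemma kink_cost_slope (R : realType) (b g m s t : R) : 0 <= b -> 0 <= g ->
  0 <= s <= t -> b * (t - s) <= kink_cost b g m t - kink_cost b g m s.
Proof.
move=> b0 g0 /andP[s0 st]; rewrite /kink_cost (max_r s0) (max_r (le_trans s0 st)).
have : g * Num.max 0 (s - m) <= g * Num.max 0 (t - m).
  by rewrite ler_wpM2l// ge_max !le_max lexx /= lerD2r st orbT.
lra.
Qed.

Lemma max0_convex (R : realType) (t x y : R) : 0 <= t <= 1 ->
  Num.max 0 (t * x + (1 - t) * y) <= t * Num.max 0 x + (1 - t) * Num.max 0 y.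
Proof.
move=> /andP[t0 t1]; have t1' : 0 <= 1 - t by lra.
rewrite ge_max addr_ge0 ?mulr_ge0 ?le_max ?lexx//=.
by rewrite lerD ?ler_wpM2l// le_max lexx orbT.
Qed.

Lemma kink_cost_function (R : realType) (b g m : R) : 0 < b -> 0 <= g ->
  0 <= m -> cost_function (kink_cost b g m).
Proof.
move=> b0 g0 m0; split.
- move=> x; have max0C (f : R -> R) : {for x, continuous f} ->
      {for x, continuous (fun s => Num.max 0 (f s))}.
    by move=> cf; apply: (@continuous_max R R (cst 0) f x) => //; exact: cvg_cst.
  apply: (@cvgD _ R^o); apply: cvgM; try exact: cvg_cst.
    by apply: max0C; exact: cvg_id.
  by apply: max0C; apply: (@cvgB _ R^o); [exact: cvg_id|exact: cvg_cst].
- move=> x x0; rewrite /kink_cost !max_l ?mulr0 ?addr0//; lra.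
- move=> t x y _ _; rewrite convRE [conv t x y](convRE (x : R^o) y) /kink_cost /unstable.onem.
  have t01 : 0 <= t%:num <= 1 by apply/andP; split.
  have H1 := max0_convex x y t01.
  have H2 := max0_convex (x - m) (y - m) t01.
  have -> : t%:num * x + (1 - t%:num) * y - m
          = t%:num * (x - m) + (1 - t%:num) * (y - m) by ring.
  have := ler_wpM2l (ltW b0) H1; have := ler_wpM2l g0 H2; lra.
- move=> x y; rewrite !in_itv /= !andbT => x0 y0 xy.
  have /(kink_cost_slope m (ltW b0) g0) : 0 <= x <= y by rewrite x0 ltW.
  have : 0 < b * (y - x) by rewrite mulr_gt0// subr_gt0.
  lra.
Qed.

Lemma kink_cost_right_derivative (R : realType) (b g m : R) : 0 < m ->
  has_right_derivative (kink_cost b g m) 0 b.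
Proof.
move=> m0; rewrite /has_right_derivative.
apply: (cvg_trans _ (@cvg_cst _ b _ (0^'+ : set_system R) _)).
apply: near_eq_cvg; near=> h.
have h0 : 0 < h by near: h; exact: nbhs_right_gt.
have hm : h <= m by near: h; exact: nbhs_right_le.
rewrite add0r !kink_costE ?lexx ?ltW//=.
by rewrite mulr0 subr0 mulfK// gt_eqF.
Unshelve. all: end_near. Qed.

(** * Payoffs and operator cost in terms of the price *)

Lemma sum_update (R : realType) (N : nat) (b : 'I_N -> R) (n : 'I_N) (x : R) :
  \sum_(m < N) [eta b with n |-> x] m = \sum_(m < N) b m - b n + x.
Proof.
rewrite (bigD1 n)//= eqxx [X in _ = X - _ + _](bigD1 n)//=.
rewrite (eq_bigr b); first by ring.
by move=> i /negbTE ->.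
Qed.

(** Parametrizing the bid sum by [p] gives [Num.sqrt B = p * Num.sqrt (N%:R * delta / alpha)], so
    that both square roots disappear. *)
Lemma payoffE (R : realType) (N : nat) (delta alpha : R) (c : 'I_N -> R -> R)
    (n : 'I_N) (b : 'I_N -> R) (p : R) :
  (0 < N)%N -> 0 < delta -> 0 < alpha -> 0 < p ->
  \sum_(m < N) b m = N%:R * delta / alpha * p ^+ 2 ->
  payoff delta alpha c n b = delta * p - b n - c n (delta - b n / p).
Proof.
move=> N0 d0 a0 p0 Bp; have NR : 0 < N%:R :> R by rewrite ltr0n.
have A0 : 0 < N%:R * delta / alpha by rewrite divr_gt0 ?mulr_gt0.
rewrite /payoff Bp.
have -> : N%:R * delta / alpha * p ^+ 2 * alpha * delta / N%:R
        = (delta * p) ^+ 2 by field; rewrite !gt_eqF.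
rewrite sqrtr_sqr ger0_norm ?mulr_ge0 ?ltW//.
rewrite sqrtrM ?ltW// sqrtr_sqr (ger0_norm (ltW p0)).
have k0 : Num.sqrt (N%:R * delta / alpha) != 0 by rewrite gt_eqF ?sqrtr_gt0.
by congr (_ - c n (_ - _)); move: k0; set k := Num.sqrt _ => k0; field;
  rewrite k0 gt_eqF.
Qed.

Lemma operator_costE (R : realType) (N : nat) (delta alpha : R)
    (b : 'I_N -> R) (y : R) : 0 < (N%:R - 1) * delta + y ->
  operator_cost delta alpha b y =
  ((delta - y) * ((\sum_(n < N) b n) / ((N%:R - 1) * delta + y)) + alpha * y)%:E.
Proof.
move=> u0; rewrite /operator_cost /clearing_price inver gt_eqF// -!EFinM -EFinD.
Qed.

(** Put [A = N%:R * delta / alpha] and [u = (N%:R - 1) * delta + y]. Since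
    [delta - y = A * alpha - u], the cost is [alpha * ((A * p) ^+ 2 / u + u)] up to a constant,
    which strictly decreases for [u <= A * p]. Hence any [y < y0] costs more than [y0]. *)
Lemma operator_cost_argmin_ge (R : realType) (N : nat) (delta alpha p : R)
    (b : 'I_N -> R) (y0 y : R) :
  0 < delta -> 0 < alpha -> (0 < N)%N -> 0 < p ->
  \sum_(m < N) b m = N%:R * delta / alpha * p ^+ 2 ->
  0 < y0 <= delta -> (N%:R - 1) * delta + y0 <= N%:R * delta / alpha * p ->
  0 <= y <= delta ->
  (operator_cost delta alpha b y <= operator_cost delta alpha b y0)%E ->
  y0 <= y.
Proof.
move=> d0 a0 N0 p0 Bp /andP[y00 y0d] y0w /andP[y_ge0 yd].
have NR : 1 <= N%:R :> R by rewrite ler1n.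
have M0 : 0 <= (N%:R - 1) * delta by rewrite mulr_ge0 ?subr_ge0// ltW.
have A0 : 0 < N%:R * delta / alpha by rewrite divr_gt0 ?mulr_gt0//; lra.
set A := N%:R * delta / alpha in Bp y0w A0.
have Aa : A * alpha = N%:R * delta by rewrite /A divfK ?gt_eqF.
have u00 : 0 < (N%:R - 1) * delta + y0 by lra.
rewrite [leRHS]operator_costE//.
(* If the denominator vanishes, then [y = 0] and the positive bid sum makes the cost [+oo]. *)
have [u_gt0|u_le0] := ltP 0 ((N%:R - 1) * delta + y); last first.
  have u0 : (N%:R - 1) * delta + y = 0 by lra.
  have y0' : y = 0 by lra.
  rewrite /operator_cost /clearing_price u0 inve0 Bp gt0_muley ?lte_fin.
    by rewrite gt0_muley ?lte_fin y0' ?subr0// mulr0 addye.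
  by rewrite mulr_gt0 ?exprn_gt0.
rewrite operator_costE// lee_fin leNgt => cost_le; rewrite leNgt.
apply: contra cost_le => lt_yy0; rewrite -subr_gt0.
set u := _ + y in u_gt0 *; set u' := _ + y0 in u00 y0w *.
have -> : (delta - y) * ((\sum_(n < N) b n) / u) + alpha * y -
  ((delta - y0) * ((\sum_(n < N) b n) / u') + alpha * y0)
  = alpha * (u' - u) * ((A * p) ^+ 2 - u * u') / (u * u').
  rewrite Bp (_ : y = u - (N%:R - 1) * delta) /u; last by ring.
  rewrite (_ : y0 = u' - (N%:R - 1) * delta) /u'; last by ring.
  rewrite -/u -/u' (_ : delta - _ = A * alpha - u); last by rewrite Aa; ring.
  rewrite (_ : delta - _ = A * alpha - u'); last by rewrite Aa; ring.
  by field; rewrite !gt_eqF.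
have uu' : u < u' by rewrite /u /u' ltrD2l.
have uu'w : u * u' < (A * p) ^+ 2.
  by rewrite expr2 (@lt_le_trans _ _ (u' * u')) ?ltr_pM2r// ler_pM// ltW.
by rewrite divr_gt0 ?mulr_gt0// subr_gt0.
Qed.

(** At [u = A * p] the cost [alpha * ((A * p) ^+ 2 / u + u)] is minimal: the excess elsewhere is the
    square [alpha * (A * p - u) ^+ 2 / u]. *)
Lemma operator_cost_argmin (R : realType) (N : nat) (delta alpha p : R)
    (b : 'I_N -> R) (y0 y : R) :
  0 < delta -> 0 < alpha -> (0 < N)%N -> 0 < p ->
  \sum_(m < N) b m = N%:R * delta / alpha * p ^+ 2 ->
  (N%:R - 1) * delta + y0 = N%:R * delta / alpha * p ->
  0 <= y <= delta ->
  (operator_cost delta alpha b y0 <= operator_cost delta alpha b y)%E.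
Proof.
move=> d0 a0 N0 p0 Bp y0w /andP[y_ge0 yd].
have NR : 1 <= N%:R :> R by rewrite ler1n.
have M0 : 0 <= (N%:R - 1) * delta by rewrite mulr_ge0 ?subr_ge0// ltW.
have A0 : 0 < N%:R * delta / alpha by rewrite divr_gt0 ?mulr_gt0//; lra.
set A := N%:R * delta / alpha in Bp y0w A0.
have Aa : A * alpha = N%:R * delta by rewrite /A divfK ?gt_eqF.
have w0 : 0 < A * p by rewrite mulr_gt0.
rewrite [leLHS]operator_costE ?y0w//.
have [u_gt0|u_le0] := ltP 0 ((N%:R - 1) * delta + y); last first.
  have u0 : (N%:R - 1) * delta + y = 0 by lra.
  have y0' : y = 0 by lra.
  rewrite /operator_cost /clearing_price u0 inve0 Bp gt0_muley ?lte_fin.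
    by rewrite gt0_muley ?lte_fin y0' ?subr0// mulr0 addye// leey.
  by rewrite mulr_gt0 ?exprn_gt0.
rewrite operator_costE// lee_fin -subr_ge0.
set u := _ + y in u_gt0 *.
have -> : (delta - y) * ((\sum_(n < N) b n) / u) + alpha * y -
  ((delta - y0) * ((\sum_(n < N) b n) / (A * p)) + alpha * y0)
  = alpha * (A * p - u) ^+ 2 / u.
  rewrite Bp (_ : y = u - (N%:R - 1) * delta) /u; last by ring.
  rewrite (_ : y0 = A * p - (N%:R - 1) * delta); last by rewrite -y0w; ring.
  rewrite -/u (_ : delta - _ = A * alpha - u); last by rewrite Aa; ring.
  rewrite (_ : delta - _ = A * alpha - A * p); last by rewrite Aa; ring.
  by field; rewrite !gt_eqF.
by rewrite divr_ge0 ?(ltW u_gt0)// mulr_ge0 ?sqr_ge0// ltW.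
Qed.

(** * Equilibrium prices *)

Lemma exists_le_mean (R : realType) (N : nat) (b : 'I_N -> R) : (0 < N)%N ->
  exists n, N%:R * b n <= \sum_(m < N) b m.
Proof.
move=> N0; apply: contrapT => /forallNP H; pose B := \sum_(m < N) b m.
have : \sum_(m < N) B < \sum_(m < N) N%:R * b m.
  apply: ltr_sum => [|i _]; last by rewrite ltNge; apply/negP/H.
  by apply/hasP; exists (Ordinal N0) => //; rewrite mem_index_enum.
by rewrite -mulr_sumr sumr_const card_ord -[B *+ N]mulr_natl ltxx.
Qed.

Lemma equilibrium_price_ge (R : realType) (N : nat) (delta alpha beta : R)
    (c : 'I_N -> R -> R) (b : 'I_N -> R) (q : \bar R) (y : R) :
  0 < delta -> 0 < alpha -> (0 < N)%N -> 0 <= beta <= alpha ->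
  (forall n s t, 0 <= s <= t -> beta * (t - s) <= c n t - c n s) ->
  price_anticipating_equilibrium delta alpha c b q y ->
  exists p : R, [/\ 0 < p,
    \sum_(m < N) b m = N%:R * delta / alpha * p ^+ 2 &
    alpha / (2 * N%:R) + beta * (1 - (2 * N%:R)^-1) <= p].
Proof.
move=> d0 a0 N0 /andP[be0 bea] slope [[b_ge0 B0] best _ _].
have NR : 1 <= N%:R :> R by rewrite ler1n.
have NR0 : 0 < N%:R :> R by lra.
have A0 : 0 < N%:R * delta / alpha by rewrite divr_gt0 ?mulr_gt0.
have pdef n x p : 0 < p ->
    \sum_(m < N) b m - b n + x = N%:R * delta / alpha * p ^+ 2 ->
    payoff delta alpha c n [eta b with n |-> x]
    = delta * p - x - c n (delta - x / p).
  move=> p0 Bp; rewrite (payoffE _ _ N0 d0 a0 p0) ?sum_update//=.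
  by rewrite eqxx.
have pdef0 n p : 0 < p ->
    \sum_(m < N) b m = N%:R * delta / alpha * p ^+ 2 ->
    payoff delta alpha c n b = delta * p - b n - c n (delta - b n / p).
  exact: payoffE.
set A := N%:R * delta / alpha in A0 pdef pdef0 *.
have Aa : A * alpha = N%:R * delta by rewrite /A divfK ?gt_eqF.
clearbody A; set B := \sum_(m < N) b m in B0 pdef pdef0 *.
pose p := Num.sqrt (B / A).
have p0 : 0 < p by rewrite sqrtr_gt0 divr_gt0.
have Bp : B = A * p ^+ 2.
  by rewrite sqr_sqrtr ?(ltW (divr_gt0 B0 A0))// mulrC divfK ?gt_eqF.
clearbody p; exists p; split=> //.
have [n bn] := exists_le_mean b N0; rewrite -/B in bn.
set p0' := _ / _ + _.
have p0'E : p0' = alpha - (alpha - beta) * (1 - (2 * N%:R)^-1).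
  by rewrite /p0'; field; rewrite gt_eqF.
have N2 : (2 * N%:R)^-1 <= 1 :> R by rewrite invf_le1 ?mulr_gt0//; lra.
(* If tenant [n] supplies nothing positive, the average bid is at least [delta * p], which already
   forces [alpha <= p]. Otherwise there is room to lower the supply. *)
have [Sle0|Sgt0] := leP (delta * p) (b n).
  have : N%:R * (delta * p) <= A * p ^+ 2.
    by rewrite -Bp (le_trans _ bn)// ler_pM2l.
  rewrite mulrA -Aa expr2 mulrA -[A * alpha * p]mulrA [alpha * p]mulrC mulrA.
  rewrite ler_pM2l ?mulr_gt0// p0'E => ap.
  by rewrite (le_trans _ ap)// lerBlDr lerDl mulr_ge0; lra.
rewrite leNgt; apply/negP => pp0'.
have N1 : 0 <= 1 - N%:R^-1 :> R by rewrite subr_ge0 invf_le1.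
have AN : 0 <= A * (1 - N%:R^-1) := mulr_ge0 (ltW A0) N1.
pose r := B - b n.
have rA : A * p ^+ 2 * (1 - N%:R^-1) <= r.
  rewrite -Bp mulrBr mulr1 lerD2l lerN2 -(ler_pM2l NR0) [leRHS]mulrC.
  by rewrite divfK ?gt_eqF// bn.
have r0 : 0 <= r.
  by rewrite (le_trans _ rA)// mulrAC mulr_ge0// sqr_ge0.
(* Raise the bid of n so that the price becomes p + h: for h > 0 below both
   bounds, the supply stays nonnegative and the payoff increases. *)
pose d := A * (p0' - p).
(* Per unit of price increase, the first-order gain of tenant [n] is at least the right-hand side
   minus [2 * A * p], that is [2 * d]. The second bound in [h] keeps the higher-order loss at most
   [d]. *)
have dE : 2 * A * p + 2 * d = delta + beta * A * (2 - N%:R^-1).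
  have -> : delta = A * alpha / N%:R by rewrite Aa mulrC mulKf ?gt_eqF.
  by rewrite /d /p0'; field; rewrite gt_eqF.
have d_gt0 : 0 < d by rewrite mulr_gt0 ?subr_gt0.
pose h := Num.min ((delta - b n / p) / (A + r / p ^+ 2)) (d / (A + beta * A / p)).
have den1 : 0 < A + r / p ^+ 2 := ltr_wpDr (divr_ge0 r0 (sqr_ge0 p)) A0.
have den2 : 0 < A + beta * A / p.
  by rewrite ltr_wpDr ?divr_ge0 ?(ltW p0)// mulr_ge0// ltW.
have S0 : 0 < delta - b n / p by rewrite subr_gt0 ltr_pdivrMr.
have h0 : 0 < h by rewrite lt_min !divr_gt0.
have h1 : h * (A + r / p ^+ 2) <= delta - b n / p.
  by rewrite -ler_pdivlMr// ge_min lexx.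
have h2 : h * (A + beta * A / p) <= d.
  by rewrite -ler_pdivlMr// ge_min lexx orbT.
clearbody h; pose x := A * (p + h) ^+ 2 - r.
have ph0 : 0 < p + h by lra.
have bnE : b n = A * p ^+ 2 - r by rewrite /r -Bp; ring.
have x0 : 0 <= x.
  rewrite (le_trans (b_ge0 n))// bnE lerD2r ler_pM2l//; nra.
have Bx : B - b n + x = A * (p + h) ^+ 2 by rewrite /x /r; ring.
have := best n x x0; rewrite sum_update Bx => /(_ (mulr_gt0 A0 (exprn_gt0 _ ph0))).
rewrite (pdef n x _ ph0 Bx) (pdef0 n p p0 Bp).
have SE : delta - b n / p - (delta - x / (p + h)) = A * h + r * h / (p * (p + h)).
  by rewrite bnE /x; field; rewrite !gt_eqF.
have pph : (p * (p + h))^-1 <= (p ^+ 2)^-1.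
  by rewrite lef_pV2 ?posrE ?mulr_gt0 ?exprn_gt0// expr2 ler_pM2l; lra.
have rpph : r * h / (p * (p + h)) <= r * h / p ^+ 2.
  by rewrite ler_wpM2l// mulr_ge0// ltW.
have /(slope n) : 0 <= delta - x / (p + h) <= delta - b n / p.
  apply/andP; split; last first.
    by rewrite -subr_ge0 SE addr_ge0// ?divr_ge0 ?mulr_ge0// ltW.
  have : h * (A + r / p ^+ 2) = A * h + r * h / p ^+ 2 by ring.
  lra.
rewrite SE => cost_drop gain.
(* The extra revenue [h * delta] plus the cost saved, at rate at least [beta], cannot exceed the
   increase of the bid. *)
have gain' : h * (delta + beta * A + beta * r / (p * (p + h))) <= h * (A * (2 * p + h)).
  have -> : h * (delta + beta * A + beta * r / (p * (p + h)))
    = h * delta + beta * (A * h + r * h / (p * (p + h))) by ring.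
  have : x - b n = h * (A * (2 * p + h)) by rewrite bnE /x; ring.
  lra.
move: gain'; rewrite ler_pM2l// leNgt => /negP; apply.
(* This combines [rA] with [1 - h / p <= p / (p + h)]. The resulting inequalities yield
   [2 * d <= d]. *)
have : A * (1 - N%:R^-1) * (1 - h / p) <= r / (p * (p + h)).
  rewrite ler_pdivlMr ?mulr_gt0// (le_trans _ rA)//.
  have -> : A * (1 - N%:R^-1) * (1 - h / p) * (p * (p + h))
      = A * (1 - N%:R^-1) * (p ^+ 2 - h ^+ 2) by field; rewrite !gt_eqF.
  by rewrite [leRHS]mulrAC ler_wpM2l// gerBl sqr_ge0.
move/(ler_wpM2l be0).
have : beta * (A * (1 - N%:R^-1) * (h / p)) <= beta * (A * (h / p)).
  by rewrite ler_wpM2l// ler_wpM2r ?(ltW (divr_gt0 h0 p0))// ler_piMr ?(ltW A0).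
have : h * (A + beta * A / p) = A * h + beta * (A * (h / p)) by ring.
lra.
Qed.

(** The formula for [p] is the first-order condition of a tenant at equal bids when the marginal
    cost is [beta]. The generation is what the supplies [delta * (1 - p / alpha)] leave over, and it
    satisfies the operator's condition [(N%:R - 1) * delta + y = N%:R * delta / alpha * p]. *)
Lemma price_anticipating_equilibrium_sym (R : realType) (N : nat)
    (delta alpha beta p : R) (c : 'I_N -> R -> R) :
  0 < delta -> 0 < alpha -> (0 < N)%N -> 0 <= beta -> 0 < p ->
  p = alpha / (2 * N%:R) + beta * (1 - (2 * N%:R)^-1) ->
  (forall n s, beta * s <= c n s) ->
  (forall n, c n (delta * (1 - p / alpha)) = beta * (delta * (1 - p / alpha))) ->
  0 <= delta - N%:R * (delta * (1 - p / alpha)) <= delta ->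
  exists q, price_anticipating_equilibrium delta alpha c
    (fun=> p ^+ 2 * delta / alpha) q
    (delta - N%:R * (delta * (1 - p / alpha))).
Proof.
move=> d0 a0 N0 be0 p0 pE c_ge c_eq y0.
have NR0 : 0 < N%:R :> R by rewrite ltr0n.
have A0 : 0 < N%:R * delta / alpha by rewrite divr_gt0 ?mulr_gt0.
have bid0 : 0 < p ^+ 2 * delta / alpha by rewrite divr_gt0 ?mulr_gt0 ?exprn_gt0.
have sumb : \sum_(m < N) (p ^+ 2 * delta / alpha) = N%:R * delta / alpha * p ^+ 2.
  by rewrite sumr_const card_ord -[LHS]mulr_natl; ring.
eexists; split=> //.
- by split=> [n|]; [exact: ltW|rewrite sumb mulr_gt0 ?exprn_gt0].
- move=> n x x0; rewrite sum_update sumb => B'0.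
  set B' := _ - _ + x in B'0.
  (* In terms of p' the payoff is concave; with the cost replaced by its
     minorant beta * s, its gap to the value at p is an explicit nonnegative
     expression. *)
  pose p' := Num.sqrt (B' / (N%:R * delta / alpha)).
  have p'0 : 0 < p' by rewrite sqrtr_gt0 divr_gt0.
  have B'E : B' = N%:R * delta / alpha * p' ^+ 2.
    by rewrite sqr_sqrtr ?(ltW (divr_gt0 B'0 A0))// [RHS]mulrC divfK ?gt_eqF.
  clearbody p'; rewrite (payoffE _ _ N0 d0 a0 p'0) ?sum_update ?sumb//=.
  rewrite (payoffE _ _ N0 d0 a0 p0)// eqxx.
  have -> : delta - p ^+ 2 * delta / alpha / p = delta * (1 - p / alpha).
    by field; rewrite !gt_eqF.
  rewrite c_eq.
  have xE : x = N%:R * delta / alpha * (p' ^+ 2 - p ^+ 2) + p ^+ 2 * delta / alpha.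
    by move: B'E; rewrite /B'; lra.
  apply: le_trans (_ : _ <= delta * p' - x - beta * (delta - x / p')) _.
    by rewrite lerD2l lerN2.
  rewrite -subr_ge0.
  have -> : delta * p - p ^+ 2 * delta / alpha - beta * (delta * (1 - p / alpha)) -
     (delta * p' - x - beta * (delta - x / p')) =
     N%:R * delta / alpha * (p - p') ^+ 2 * (1 + beta * (1 - N%:R^-1) / p').
    (* Eliminating [alpha] through the first-order condition turns the gap into a rational
       identity. *)
    have alphaE : alpha = 2 * N%:R * p - beta * (2 * N%:R - 1).
      by rewrite pE; field; rewrite gt_eqF.
    rewrite xE; move: a0; rewrite {pE c_eq y0 A0 bid0 sumb B'0 B'E xE B'} alphaE => a0.
    by field; rewrite !gt_eqF.
  apply: mulr_ge0; first exact: mulr_ge0 (ltW A0) (sqr_ge0 _).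
  apply: addr_ge0 => //; apply: divr_ge0 (ltW p'0); apply: mulr_ge0 => //.
  by rewrite subr_ge0 invf_le1// ler1n.
- split=> // y; apply: operator_cost_argmin p0 sumb _ => //.
  by field; rewrite gt_eqF.
Qed.

(** * Socially optimal generation *)

Lemma social_optimal_kink (R : realType) (N : nat) (delta alpha beta m : R) :
  0 <= beta <= alpha -> 0 <= m -> 0 <= delta - N%:R * m ->
  social_optimal delta alpha (fun _ : 'I_N => kink_cost beta alpha m)
    (fun=> m) (delta - N%:R * m).
Proof.
move=> /andP[b0 ba] m0 y0; split.
  by split=> //; rewrite sumr_const card_ord -[m *+ N]mulr_natl subrK.
move=> s y [sy s0 _]; rewrite /social_cost.
have cost_m : \sum_(i < N) kink_cost beta alpha m m = N%:R * (beta * m).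
  by rewrite sumr_const card_ord -[LHS]mulr_natl kink_costE// m0 lexx.
rewrite cost_m.
(* The line of slope [alpha] through the kink supports the cost from below. Summed, it makes the
   lower bound on the social cost independent of [y]. *)
have : \sum_(i < N) (alpha * s i - (alpha - beta) * m)
       <= \sum_(i < N) kink_cost beta alpha m (s i).
  apply: ler_sum => i _; have [sm|ms] := leP (s i) m.
    rewrite kink_costE ?s0//.
    have : 0 <= (alpha - beta) * (m - s i) by rewrite mulr_ge0 ?subr_ge0.
    lra.
  rewrite /kink_cost !max_r ?subr_ge0 ?(ltW ms)//.
  have : 0 <= beta * (s i - m) by rewrite mulr_ge0 ?subr_ge0 // ltW.
  lra.
rewrite big_split /= -mulr_sumr sumr_const card_ord -mulr_natl.
have -> : \sum_(i < N) s i = delta - y by rewrite -sy; ring.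
lra.
Qed.

(** Bounds every optimum, not only the one exhibited: the social cost is at least
    [alpha * y + beta * (delta - y)], which increases with [y] and is attained by supplying [m]
    each. *)
Lemma social_optimal_generation_le (R : realType) (N : nat)
    (delta alpha beta m : R) (c : 'I_N -> R -> R) (s : 'I_N -> R) (y : R) :
  beta < alpha -> 0 <= m -> 0 <= delta - N%:R * m ->
  (forall n t, beta * t <= c n t) -> (forall n, c n m = beta * m) ->
  social_optimal delta alpha c s y -> y <= delta - N%:R * m.
Proof.
move=> ba m0 y0 c_ge c_eq [[sy _ _] opt].
have /opt : social_feasible delta (fun _ : 'I_N => m) (delta - N%:R * m).
  by split=> //; rewrite sumr_const card_ord -[m *+ N]mulr_natl subrK.
have cost_m : \sum_(i < N) c i m = N%:R * (beta * m).
  by under eq_bigr do rewrite c_eq; rewrite sumr_const card_ord -[LHS]mulr_natl.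
rewrite /social_cost cost_m.
have : \sum_(i < N) beta * s i <= \sum_(i < N) c i (s i) by exact: ler_sum.
rewrite -mulr_sumr (_ : \sum_(i < N) s i = delta - y); last by rewrite -sy; ring.
move=> H1 H2; rewrite -subr_ge0 -(pmulr_rge0 _ (_ : 0 < alpha - beta)); lra.
Qed.

Theorem theorem13 (R : realType) (delta alpha : R)
    (delta_gt0 : 0 < delta) (alpha_gt0 : 0 < alpha)
    (eps : R) (eps_gt0 : 0 < eps) (N : nat) (N_ge1 : (1 <= N)%N) :
  exists c : 'I_N -> R -> R,
    [/\ (forall n, cost_function (c n)),
        (exists (s : 'I_N -> R) (ystar : R),
           social_optimal delta alpha c s ystar /\ 0 < ystar),
        (forall n, exists l : R,
           has_right_derivative (c n) 0 l /\ alpha / (2 * N%:R) <= l),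
        (exists (b : 'I_N -> R) (p : \bar R) (ya : R),
           price_anticipating_equilibrium delta alpha c b p ya) &
        forall (s : 'I_N -> R) (ystar : R)
               (b : 'I_N -> R) (p : \bar R) (ya : R),
          social_optimal delta alpha c s ystar ->
          price_anticipating_equilibrium delta alpha c b p ya ->
          delta - eps <= ya - ystar].
Proof.
have NR : 1 <= N%:R :> R by rewrite ler1n.
have NR0 : 0 < N%:R :> R by lra.
(* The target is [ystar <= e] and [delta - e <= ya]. The bound [2 * e <= delta] places the
   equilibrium supply before the kink. *)
have [e [e_gt0 e_delta e_eps]] : exists e : R, [/\ 0 < e, 2 * e <= delta & 2 * e <= eps].
  exists (Num.min delta eps / 2); rewrite divr_gt0 ?lt_min ?delta_gt0//.
  by split=> //; rewrite mulrC divfK// ge_min lexx ?orbT.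
pose k : R := (2 * N%:R)^-1.
have kN : k * N%:R = 2^-1 by rewrite /k invfM mulrAC mulfK ?gt_eqF.
have k0 : 0 < k by rewrite invr_gt0 mulr_gt0.
have k1 : k <= 2^-1 by nra.
(* [eta] is the relative gap between [beta] and [alpha], scaled so that the total supply at the
   symmetric equilibrium is [e * (1 - k)]. *)
pose eta := e / (N%:R * delta).
have Nd : 0 < N%:R * delta by rewrite mulr_gt0.
have etaE : N%:R * delta * eta = e by rewrite /eta mulrC divfK ?gt_eqF.
have eta0 : 0 < eta by rewrite divr_gt0.
have etak : eta <= k.
  rewrite ler_pdivrMr// mulrA kN; lra.
clearbody eta.
pose beta := alpha * (1 - eta).
have bk : alpha * k <= beta by rewrite ler_pM2l; lra.
have b0 : 0 < beta by rewrite mulr_gt0; lra.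
have ba : beta < alpha by rewrite gtr_pMr; lra.
(* This kink makes the optimal generation exactly [e]. *)
pose m := (delta - e) / N%:R.
have m0 : 0 < m by rewrite divr_gt0; lra.
have Nm : delta - N%:R * m = e by rewrite /m mulrC divfK ?gt_eqF//; ring.
pose p := alpha / (2 * N%:R) + beta * (1 - (2 * N%:R)^-1).
have pE : p = alpha * (1 - eta * (1 - k)) by rewrite /p /beta -/k; ring.
have p0 : 0 < p by rewrite pE mulr_gt0//; nra.
have sE : delta * (1 - p / alpha) = delta * eta * (1 - k).
  by rewrite pE; field; rewrite gt_eqF.
have NsE : N%:R * (delta * (1 - p / alpha)) = e * (1 - k).
  by rewrite sE -etaE; ring.
have ek0 : 0 <= e * k by rewrite mulr_ge0 ?ltW.
have ek1 : e * k <= e by rewrite ler_piMr; lra.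
have s_bnd : 0 <= delta * (1 - p / alpha) <= m.
  rewrite -(ler_pM2l NR0 0) -[X in _ && X](ler_pM2l NR0) mulr0 NsE.
  apply/andP; split; first lra.
  have -> : N%:R * m = delta - e by rewrite -Nm; ring.
  lra.
have y_bnd : delta - e <= delta - N%:R * (delta * (1 - p / alpha)) <= delta.
  by rewrite NsE; apply/andP; split; lra.
exists (fun=> kink_cost beta alpha m); split.
- by move=> _; apply: kink_cost_function => //; exact: ltW.
- exists (fun=> m), (delta - N%:R * m); split; last by rewrite Nm.
  by apply: social_optimal_kink; rewrite ?Nm ?(ltW b0)/= ltW.
- move=> _; exists beta; split; first exact: kink_cost_right_derivative.
  exact: bk.
- have [n t|n||q equil] := price_anticipating_equilibrium_sym
    (c := fun _ : 'I_N => kink_cost beta alpha m)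
    delta_gt0 alpha_gt0 N_ge1 (ltW b0) p0 erefl.
  + by apply: kink_cost_ge_linear; exact: ltW.
  + by rewrite kink_costE.
  + by move: y_bnd => /andP[? ->]; rewrite andbT; lra.
  + by do 3 eexists; exact: equil.
- move=> s ystar b q ya opt equil.
  have ystar_e : ystar <= e.
    rewrite -Nm; apply: (social_optimal_generation_le ba _ _ _ _ opt) => //.
    + exact: ltW.
    + by rewrite Nm ltW.
    + by move=> _ t; apply: kink_cost_ge_linear; exact: ltW.
    + by move=> _; rewrite kink_costE ?lexx ?ltW.
  have b_bnd : 0 <= beta <= alpha by rewrite !ltW.
  have slope (n : 'I_N) t u (tu : 0 <= t <= u) :=
    kink_cost_slope m (ltW b0) (ltW alpha_gt0) tu.
  have [p' [p'0 Bp' pp']] :=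
    equilibrium_price_ge delta_gt0 alpha_gt0 N_ge1 b_bnd slope equil.
  case: equil => _ _ _ [ya_bnd argmin].
  move: y_bnd => /andP[y1 y2].
  (* Since [p <= p'], the generation of the symmetric equilibrium lies in the range where the
     operator's cost still decreases, so [ya] is no smaller. *)
  suff : delta - N%:R * (delta * (1 - p / alpha)) <= ya by lra.
  apply: (operator_cost_argmin_ge delta_gt0 alpha_gt0 N_ge1 p'0 Bp' _ _ ya_bnd).
  + by rewrite y2 andbT; lra.
  + have -> : (N%:R - 1) * delta + (delta - N%:R * (delta * (1 - p / alpha)))
      = N%:R * delta / alpha * p by field; rewrite gt_eqF.
    by rewrite ler_pM2l// divr_gt0.
  + by apply: argmin; rewrite y2 andbT; lra.
Qed.
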